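(* The set of positive integers $m$ such that $d(m)=f(m)$ has asymptotic density $1$.
   Context: For a positive integer $m$, let $\varphi(m)$ be Euler's function and $\lambda(m)$ the Carmichael function (the exponent of the multiplicative group $(\mathbb{Z}/m\mathbb{Z})^*$). Let $\mathrm{rad}(m)$ be the product of the distinct primes dividing $m$. Let $\delta=2$ if $4\mid m$ and $\delta=1$ otherwise. Define $$ d(m)=\gcd\big(m,\ \delta\,\varphi(\mathrm{rad}(m))\big),\qquad f(m)=\gcd\big(m,\ \delta\,\lambda(m)\varphi(\mathrm{rad}(m))/\varphi(m)\big). $$ *)

(* Defs.v *)
From HB Require Import structures.
From mathcomp Require Import all_boot all_order all_algebra all_fingroup all_solvable.
Set Implicit Arguments. Unset Strict Implicit. Unset Printing Implicit Defensive.

Definition rad (m : nat) : nat := \prod_(p <- primes m) p.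

(* Carmichael function: the exponent of the unit group (Z/mZ)^*.
   For m >= 2, 'Z_m is Z/mZ; for m = 1, 'Z_1 is Z/2Z whose unit group is
   trivial, giving exponent 1 = lambda(1), as expected. *)
Definition carmichael (m : nat) : nat := exponent [set: {unit 'Z_m}].

Definition delta (m : nat) : nat := if 4 %| m then 2 else 1.

Definition dfun (m : nat) : nat := gcdn m (delta m * totient (rad m)).

(* the quotient delta*lambda(m)*phi(rad m)/phi(m) is an exact division *)
Definition ffun (m : nat) : nat :=
  gcdn m ((delta m * carmichael m * totient (rad m)) %/ totient m).

Definition count_df (N : nat) : nat := count (fun m => dfun m == ffun m) (iota 1 N).

(* Main.v *)
From HB Require Import structures.
From mathcomp Require Import all_boot all_order all_algebra.
From mathcomp Require Import all_fingroup all_solvable all_field.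
From mathcomp Require Import all_classical all_reals all_analysis.
From mathcomp Require Import zify ring lra.
Require Import Defs.
Set Implicit Arguments. Unset Strict Implicit. Unset Printing Implicit Defensive.
Import Order.TTheory GRing.Theory Num.Theory.
Import numFieldNormedType.Exports.

(* Comparing [p]-adic valuations, [d(m) = f(m)] as soon as every prime [p] with
   [p^2 | m], say [p^a || m], admits a prime [q | m] with [p^(2a-1) | q - 1]: then
   [p^(2a-1)] divides both [lambda(m)] and [phi(rad m)], and both gcds have
   [p]-adic valuation [a].  The integers divisible by [p^2] for some large [p], or
   by a high power of some small [p], have small density, so it suffices that for
   every [n] almost all integers have a prime factor [q = 1 mod n].  By a sieve this
   amounts to the divergence of the sum of [1/q] over the primes [q = 1 mod n].

   The divergence is proved for the primes modulo which a monic irreducible [f] of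
   degree [d] has a root, by counting in [Z[x]/f].  Suppose the sum converges, and
   let [N] be the norm, i.e. the determinant of [g(C)] for a companion matrix [C]
   of [f].  A prime [q] modulo which [f] has no root divides a norm only if [q^2]
   does.  Nonzero elements with coefficients of size [t] have norm [O(t^d)], hence
   by pigeonhole at most [O(Y^d / q)] (resp. [O(Y^d / q^2)]) elements [1 + Q g], with
   [g] in the box [[0,Y)^d], have a norm divisible by [q], up to a bounded term.
   With [Q = z!] no prime up to [z] occurs, so for [z] and then [Y] large a positive
   proportion of these elements have norm 1 or -1.  But the norm is a monic
   polynomial of degree [d] in the constant coefficient, so there are only
   [O(Y^(d-1))] such elements. *)

Local Open Scope ring_scope.

(** * Norms of matrix polynomials *)

(** A Bezout relation gives the inverse. Conversely, write the minimal polynomial as [k * h] with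
    [h] the gcd: [h(A)] is invertible as a factor of [p(A)], so [k(A) = 0], and minimality makes [h]
    constant. *)
Lemma horner_mx_unitE (F : fieldType) (D : nat) (A : 'M[F]_D.+1) (p : {poly F}) :
  (horner_mx A p \in unitmx) = coprimep p (mxminpoly A).
Proof.
apply/idP/idP => [pu|/Bezout_eq1_coprimepP[[u v] /= Huv]]; last first.
  have: horner_mx A u *m horner_mx A p = 1%:M.
    rewrite -[_ *m _]/(_ * _) -rmorphM /=; move/(congr1 (horner_mx A)): Huv.
    by rewrite rmorphD !rmorphM /= mx_root_minpoly mulr0 addr0 rmorph1.
  by case/mulmx1_unit.
rewrite /coprimep; set h := gcdp _ _.
have /dvdpP[k Ek] : h %| mxminpoly A := dvdp_gcdr _ _.
have /dvdpP[l El] : h %| p := dvdp_gcdl _ _.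
have hu : horner_mx A h \in unitmx.
  move: pu; rewrite El rmorphM /= [_ * _]/(_ *m _).
  by rewrite unitmx_mul => /andP[].
have k0 : horner_mx A k = 0.
  have : horner_mx A k *m horner_mx A h = 0.
    rewrite -[_ *m _]/(_ * _) -rmorphM /= -Ek; exact: mx_root_minpoly.
  by move/(congr1 (mulmx^~ (invmx (horner_mx A h)))); rewrite mulmxK // mul0mx.
have := mxminpoly_min k0.
have mp0 : mxminpoly A != 0 by rewrite monic_neq0 // mxminpoly_monic.
have kn0 : k != 0 by apply: contraNneq mp0 => E; rewrite Ek E mul0r.
have hn0 : h != 0 by apply: contraNneq mp0 => E; rewrite Ek E mulr0.
move/dvdp_leq => /(_ kn0); rewrite {1}Ek size_mul //.
have : (0 < size k)%N by rewrite size_poly_gt0.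
have : (0 < size h)%N by rewrite size_poly_gt0.
case: (size h) => [|[|s]] // _; rewrite addnS /= addnS => _.
by rewrite ltnNge leq_addr.
Qed.

(** The gcds with [m] are nonconstant and pairwise coprime, so their product, of degree at least
    [#|S|], divides [m]. *)
Lemma coprimep_family_card (F : fieldType) (T : finType) (S : {set T})
    (p : T -> {poly F}) (m : {poly F}) :
  m != 0 ->
  {in S, forall x, ~~ coprimep (p x) m} ->
  {in S &, forall x y, x != y -> coprimep (gcdp (p x) m) (gcdp (p y) m)} ->
  (#|S| < size m)%N.
Proof.
move=> m0 H1 H2; rewrite cardE.
have {H1} H1 x : x \in enum S -> (1 < size (gcdp (p x) m))%N.
  rewrite mem_enum => /H1; rewrite /coprimep.
  have : gcdp (p x) m != 0 by rewrite gcdp_eq0 (negbTE m0) andbF.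
  by rewrite -size_poly_gt0; case: size => [|[|]].
have {H2} H2 : {in enum S &, forall x y, x != y ->
    coprimep (gcdp (p x) m) (gcdp (p y) m)}.
  by move=> x y; rewrite !mem_enum; apply: H2.
have Hd : \prod_(x <- enum S) gcdp (p x) m %| m.
  elim: (enum S) (enum_uniq S) H2 => [|x s IH] /=; first by rewrite big_nil dvd1p.
  move=> /andP[xs us] H2; rewrite big_cons Gauss_dvdp.
    rewrite dvdp_gcdr IH // => y z ys zs; apply: H2; rewrite inE ?ys ?zs orbT //.
  rewrite big_seq; elim/big_ind: _ => [|a b ha hb|y ys]; first exact: coprimep1.
    by rewrite coprimepMr ha hb.
  by apply: H2; rewrite ?inE ?eqxx ?ys ?orbT //; apply: contraNneq xs => ->.
apply: leq_trans (dvdp_leq m0 Hd).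
elim: (enum S) H1 => [|x s IH] H1; first by rewrite big_nil size_poly1.
have Hx := H1 x (mem_head _ _).
have {}IH := IH (fun y ys => H1 y (mem_behead (s:=x::s) ys)).
rewrite big_cons size_mul; first last.
- by rewrite -size_poly_gt0 (leq_ltn_trans _ IH).
- by rewrite -size_poly_gt0 (ltn_trans _ Hx).
by move: Hx IH => /=; lia.
Qed.

Lemma norm_det_le (n : nat) (A : 'M[int]_n) (E : int) :
  (forall i j, `|A i j| <= E) -> `|\det A| <= E ^+ n *+ n`!.
Proof.
move=> HA; rewrite /determinant.
apply: le_trans (ler_norm_sum _ _ _) _.
apply: le_trans (_ : \sum_(s : 'S_n) E ^+ n <= _).
  apply: ler_sum => s _; rewrite normrM normrX normrN1 expr1n mul1r.
  rewrite normr_prod -[X in E ^+ X]card_ord -prodr_const.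
  by apply: ler_prod => i _; rewrite normr_ge0 HA.
by rewrite sumr_const card_Sn.
Qed.

Lemma horner_mx_sum (R : comNzRingType) (D n : nat) (C : 'M[R]_D.+1) (g : {poly R}) :
  (size g <= n)%N -> horner_mx C g = \sum_(i < n) g`_i *: C ^+ i.
Proof.
move=> sg; have {1}-> : g = \poly_(i < n) g`_i.
  apply/polyP => i; rewrite coef_poly; case: ltnP => // ni.
  by rewrite nth_default // (leq_trans sg).
rewrite poly_def rmorph_sum; apply: eq_bigr => i _.
by rewrite /= horner_mxZ rmorphXn /= horner_mx_X.
Qed.

Lemma norm_horner_mx_bound (D : nat) (C : 'M[int]_D.+1) :
  exists K : nat, (0 < K)%N /\ forall (t : nat) (g : {poly int}),
    (size g <= D.+1)%N -> (forall i, (`|(g`_i)%R| <= t)%N) ->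
    (`|\det (horner_mx C g)| <= K * t ^ D.+1)%N.
Proof.
pose L := (\sum_(i < D.+1) \sum_j \sum_k `|(C ^+ i) j k|)%N.
exists (L ^ D.+1 * D.+1`!).+1; split=> // t g sg gt.
have -> : (`|\det (horner_mx C g)| <= (L ^ D.+1 * D.+1`!).+1 * t ^ D.+1)%N =
    (`|\det (horner_mx C g)| <= ((L ^ D.+1 * D.+1`!).+1 * t ^ D.+1)%N%:Z).
  by rewrite -abszE lez_nat.
apply: le_trans (norm_det_le (E := (t * L)%N) _) _.
  move=> j k; rewrite (horner_mx_sum _ sg) summxE.
  apply: le_trans (ler_norm_sum _ _ _) _.
  apply: le_trans (_ : \sum_(i < D.+1) (t * `|(C ^+ i) j k|)%N%:Z <= _).
    apply: ler_sum => i _; rewrite mxE normrM PoszM -!abszE.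
    by rewrite -!PoszM lez_nat leq_mul2r gt orbT.
  rewrite -[X in X <= _](big_morph Posz PoszD (erefl 0%:Z)) lez_nat.
  rewrite -big_distrr /= leq_mul2l; apply/orP; right.
  apply: leq_sum => i _.
  rewrite (bigD1 j) //= (bigD1 k) //= -!addnA; exact: leq_addr.
have -> : ((t * L)%N%:Z) ^+ D.+1 *+ D.+1`! = ((t * L) ^ D.+1 * D.+1`!)%N%:Z.
  by rewrite -mulr_natr -!natz !natrM natrX natrM.
rewrite lez_nat expnMn.
by rewrite mulSn -mulnA mulnC mulnAC leq_addl.
Qed.

Lemma intr_Fp_eq0 (q : nat) (x : int) : prime q ->
  (x%:~R == 0 :> 'F_q) = (q %| x)%Z.
Proof. by move=> pq; rewrite (dvdz_pcharf (pchar_Fp pq)). Qed.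

Lemma dvdz_det_unitmx (n q : nat) (A : 'M[int]_n) : prime q ->
  (q %| \det A)%Z = (map_mx intr A \notin @unitmx 'F_q n).
Proof.
by move=> pq; rewrite unitmxE det_map_mx unitfE intr_Fp_eq0 // negbK.
Qed.

(** Row operations invertible modulo [q], lifted to the integers, make two rows divisible by [q];
    the determinant of the lift is prime to [q]. *)
Lemma dvdz_sqr_det (n q : nat) (A : 'M[int]_n) : prime q ->
  (\rank (map_mx intr A : 'M['F_q]_n) + 2 <= n)%N -> ((q ^ 2)%N %| \det A)%Z.
Proof.
move=> pq; set Aq := map_mx _ A => rk.
pose W := invmx (col_ebase Aq).
have Wu : W \in unitmx by rewrite unitmx_inv col_ebase_unit.
have WA : W *m Aq = pid_mx (\rank Aq) *m row_ebase Aq.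
  by rewrite -[X in W *m X](mulmx_ebase Aq) -!mulmxA mulKmx // col_ebase_unit.
pose Wi : 'M[int]_n := map_mx (fun x : 'F_q => (x : nat)%:Z) W.
have WiE : map_mx intr Wi = W.
  apply/matrixP => i j; rewrite !mxE /= -[X in _ = X]natr_Zp.
  by [].
have rows (i j : 'I_n) : (\rank Aq <= i)%N -> (q %| (Wi *m A) i j)%Z.
  move=> ri; rewrite -intr_Fp_eq0 //.
  have -> : ((Wi *m A) i j)%:~R = (map_mx intr (Wi *m A) : 'M['F_q]_n) i j.
    by rewrite [RHS]mxE.
  rewrite map_mxM WiE WA mxE big1 // => k _.
  by rewrite mxE ltnNge ri andbF mul0r.
case: n => [|[|n]] in A Aq rk W Wu WA Wi WiE rows *.
- by rewrite addn2 in rk.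
- by rewrite addn2 in rk.
have : ((q ^ 2)%N %| \det (Wi *m A))%Z.
  apply: rpred_sum => s _; apply: dvdz_mull.
  rewrite (bigD1 ord_max) //= (bigD1 (inord n)) /=; last first.
    by apply/eqP => /(congr1 val) /=; rewrite inordK; lia.
  rewrite mulrA dvdz_mulr // -mulnn PoszM dvdz_mul // rows //=; first by lia.
  by rewrite inordK; lia.
rewrite det_mulmx Gauss_dvdzr // coprimezE /= coprime_pexpl //.
move: Wu; rewrite unitmxE -WiE det_map_mx unitfE intr_Fp_eq0 //.
by rewrite prime_coprime.
Qed.

(** If [g(C)] had corank one modulo [q], its kernel would be a line stable under [C], hence spanned
    by an eigenvector, and the characteristic polynomial would have a root. *)
Lemma dvdz_sqr_det_horner_mx (D q : nat) (C : 'M[int]_D.+1) (g : {poly int}) :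
  prime q ->
  (forall r, ~~ root (char_poly (map_mx intr C : 'M['F_q]_D.+1)) r) ->
  (q %| \det (horner_mx C g))%Z -> ((q ^ 2)%N %| \det (horner_mx C g))%Z.
Proof.
move=> pq noroot; rewrite dvdz_det_unitmx // => sing; apply: dvdz_sqr_det => //.
move: sing; rewrite map_horner_mx; set Cq := map_mx _ C in noroot *.
set Aq := horner_mx _ _; rewrite -row_free_unit -kermx_eq0 => ker0.
rewrite leqNgt; apply/negP => rk.
have rk1 : (\rank (kermx Aq) <= 1)%N by rewrite mxrank_ker; lia.
pose v := nz_row (kermx Aq).
have v0 : v != 0 by rewrite nz_row_eq0.
have vK : (v <= kermx Aq)%MS by exact: nz_row_sub.
have Kv : (kermx Aq <= v)%MS.
  by rewrite -(mxrank_leqif_sup vK) eqn_leq mxrankS // rank_rV v0.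
have : (v *m Cq <= v)%MS.
  apply: submx_trans Kv; apply: submx_trans (submxMr Cq vK) _.
  by apply: comm_mx_stable_ker; apply: comm_horner_mx.
case/sub_rVP => a va.
have := noroot a; rewrite -eigenvalue_root_char => /negP; apply.
by apply/eigenvalueP; exists v.
Qed.

(** Modulo [q], a common factor of [1 + Q c_x] and [1 + Q c_y] divides [Q (c_x - c_y)], where [Q] is
    invertible and [c_x - c_y] is coprime to the minimal polynomial. So the gcds with that
    polynomial are pairwise coprime, and its degree bounds their number. *)
Lemma norm_family_card (D q : nat) (C : 'M[int]_D.+1) (T : finType) (S : {set T})
    (c : T -> {poly int}) (Q : int) :
  prime q -> ~~ (q %| Q)%Z ->
  {in S, forall x, (q %| \det (horner_mx C (1 + Q *: c x)))%Z} ->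
  {in S &, forall x y, x != y -> ~~ (q %| \det (horner_mx C (c x - c y)))%Z} ->
  (#|S| <= D.+1)%N.
Proof.
move=> pq qQ H1 H2.
pose Cq : 'M['F_q]_D.+1 := map_mx intr C.
have m0 : mxminpoly Cq != 0 by rewrite monic_neq0 // mxminpoly_monic.
have Hdvd g : (q %| \det (horner_mx C g))%Z =
    ~~ coprimep (map_poly intr g) (mxminpoly Cq).
  by rewrite dvdz_det_unitmx // map_horner_mx horner_mx_unitE.
rewrite -ltnS; apply: leq_trans (_ : size (mxminpoly Cq) <= _)%N; last first.
  rewrite -(size_char_poly Cq); apply: dvdp_leq (mxminpoly_dvd_char _).
  by rewrite monic_neq0 // char_poly_monic.
apply: (coprimep_family_card (p := fun x => map_poly intr (1 + Q *: c x))) => //.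
  by move=> x xS; rewrite -Hdvd H1.
move=> x y xS yS xy; have := H2 _ _ xS yS xy; rewrite Hdvd negbK => cop.
have Qu : (Q%:~R : 'F_q) != 0 by rewrite intr_Fp_eq0.
apply/coprimepP => h hx hy; move/coprimepP: cop; apply; last first.
  exact: dvdp_trans hx (dvdp_gcdr _ _).
rewrite -(dvdpZr _ _ Qu) -map_polyZ /=.
have -> : Q *: (c x - c y) = (1 + Q *: c x) - (1 + Q *: c y).
  by rewrite scalerBr opprD addrACA subrr add0r.
rewrite rmorphB /= dvdp_sub //.
  exact: dvdp_trans hx (dvdp_gcdl _ _).
exact: dvdp_trans hy (dvdp_gcdl _ _).
Qed.

Lemma char_poly_hornerE (R : comNzRingType) (n : nat) (A : 'M[R]_n) (a : R) :
  (char_poly A).[a] = \det (a%:M - A).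
Proof.
rewrite /char_poly -horner_evalE -det_map_mx; congr (\det _).
apply/matrixP => i j; rewrite !mxE /= horner_evalE !hornerE.
by rewrite hornerMn hornerX.
Qed.

(** The determinant is the value at [Q x] of the characteristic polynomial of [- A], monic of degree
    [D.+1]. *)
Lemma det_shift_eq_card (D Y : nat) (A : 'M[int]_D.+1) (Q e : int) : Q != 0 ->
  (#|[set x : 'I_Y | \det ((Q * (x : nat)%:Z)%:M + A) == e]| <= D.+1)%N.
Proof.
move=> Q0; pose p := char_poly (- A) - e%:P.
have sp : size p = D.+2.
  by rewrite size_polyDl size_char_poly // size_polyN (leq_ltn_trans (size_polyC_leq1 _)).
have p0 : p != 0 by rewrite -size_poly_gt0 sp.
rewrite cardE; set s := enum _.
have := @max_poly_roots _ p (map (fun x : 'I_Y => Q * (x : nat)%:Z) s) p0.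
rewrite size_map sp ltnS; apply.
  apply/allP => y /mapP[x]; rewrite mem_enum inE => /eqP Hx ->.
  rewrite /root !hornerE char_poly_hornerE opprK Hx; exact/eqP/subrr.
rewrite map_inj_uniq ?enum_uniq // => x y /(mulfI Q0) [] /=; exact: val_inj.
Qed.

(** * Counting in a box *)

Definition root_mod (D : nat) (C : 'M[int]_D.+1) (q : nat) : bool :=
  [exists r : 'F_q, root (char_poly (map_mx intr C)) r].

(* The power of [q] that divides [\det (horner_mx C g)] as soon as [q] does. *)
Definition norm_step (D : nat) (C : 'M[int]_D.+1) (q : nat) : nat :=
  if root_mod C q then q else (q ^ 2)%N.

Lemma leq_norm_step (D : nat) (C : 'M[int]_D.+1) (q : nat) : (q <= norm_step C q)%N.
Proof.
rewrite /norm_step; case: ifP => // _.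
by case: q => // q; rewrite expnS leq_pmulr.
Qed.

Lemma norm_step_dvdz (D : nat) (C : 'M[int]_D.+1) (q : nat) (g : {poly int}) :
  prime q -> (q %| \det (horner_mx C g))%Z ->
  (norm_step C q %| `|\det (horner_mx C g)|)%N.
Proof.
move=> pq qg; rewrite /norm_step; case: ifP => // nr.
apply: dvdz_sqr_det_horner_mx => // r; apply/negP => rr.
by move/existsP: nr; apply; exists r.
Qed.

Definition box_poly (D Y : nat) (x : {ffun 'I_D.+1 -> 'I_Y}) : {poly int} :=
  \poly_(i < D.+1) (x (inord i) : nat)%:Z.

Lemma coef_box_poly (D Y : nat) (x : {ffun 'I_D.+1 -> 'I_Y}) (i : 'I_D.+1) :
  (box_poly x)`_i = (x i : nat)%:Z.
Proof. by rewrite coef_poly ltn_ord inord_val. Qed.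

Lemma size_box_poly (D Y : nat) (x : {ffun 'I_D.+1 -> 'I_Y}) :
  (size (box_poly x) <= D.+1)%N.
Proof. exact: size_poly. Qed.

Lemma box_poly_inj (D Y : nat) : injective (@box_poly D Y).
Proof.
move=> x y E; apply/ffunP => i; apply: val_inj.
by have := coef_box_poly x i; rewrite E coef_box_poly => -[].
Qed.

(* Two points of a cell of side [t] that share a factor modulo [q] would have a
   difference whose norm is too small to be a multiple of [norm_step C q]. *)
Lemma box_bad_card (D : nat) (C : 'M[int]_D.+1) (K Y Q q t : nat) :
  (forall g : {poly int}, (size g <= D.+1)%N -> g != 0 -> \det (horner_mx C g) != 0) ->
  (forall (s : nat) (g : {poly int}),
    (size g <= D.+1)%N -> (forall i, (`|(g`_i)%R| <= s)%N) ->
    (`|\det (horner_mx C g)| <= K * s ^ D.+1)%N) ->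
  prime q -> ~~ (q %| Q)%N -> (0 < t)%N -> (K * t ^ D.+1 < norm_step C q)%N ->
  (#|[set x : {ffun 'I_D.+1 -> 'I_Y} |
       (q %| \det (horner_mx C (1 + Q%:Z *: box_poly x)))%Z]|
    <= D.+1 * (Y %/ t).+1 ^ D.+1)%N.
Proof.
move=> nz HK pq qQ t0 Kt; set S := [set x | _].
pose cell (x : {ffun 'I_D.+1 -> 'I_Y}) : {ffun 'I_D.+1 -> 'I_(Y %/ t).+1} :=
  [ffun i => inord (x i %/ t)].
rewrite -sum1_card (partition_big cell predT) //=.
apply: (@leq_trans (\sum_(j : {ffun 'I_D.+1 -> 'I_(Y %/ t).+1}) D.+1)%N); last first.
  by rewrite sum_nat_const card_ffun !card_ord mulnC.
apply: leq_sum => y _; rewrite sum1dep_card.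
apply: (@norm_family_card D q C _ _ (@box_poly D Y) Q) => //.
  by move=> x; rewrite !inE => /andP[].
move=> a b; rewrite !inE => /andP[_ /eqP ca] /andP[_ /eqP cb] ab.
apply/negP => /(norm_step_dvdz pq); set g := _ - _.
have sg : (size g <= D.+1)%N.
  by rewrite (leq_trans (size_polyD _ _)) // size_polyN geq_max !size_box_poly.
have g0 : g != 0 by rewrite subr_eq0; apply: contra ab => /eqP/box_poly_inj->.
move/dvdn_leq; rewrite absz_gt0 nz // => /(_ isT) /(leq_trans Kt).
rewrite ltnNge HK // => i; rewrite coefB.
case: (ltnP i D.+1) => iD; last first.
  by rewrite !nth_default ?subrr // (leq_trans (size_box_poly _)).
rewrite -[i]/(nat_of_ord (Ordinal iD)) !coef_box_poly.
have : cell a (Ordinal iD) = cell b (Ordinal iD) by rewrite ca cb.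
rewrite !ffunE => /(congr1 val) /=.
rewrite !inordK ?ltnS ?leq_div2r ?(ltnW (ltn_ord _)) //.
move: (a _ : nat) (b _ : nat) => m n E.
rewrite (divn_eq m t) (divn_eq n t) E; move: (ltn_pmod m t0) (ltn_pmod n t0).
lia.
Qed.

(** On each of the [Y ^ D] fibres of [tail] only the constant coefficient varies, so each of the
    norms 1 and -1 is taken at most [D.+1] times. *)
Lemma box_unit_card (D : nat) (C : 'M[int]_D.+1) (Y Q : nat) : (0 < Q)%N ->
  (#|[set x : {ffun 'I_D.+1 -> 'I_Y} |
       `|\det (horner_mx C (1 + Q%:Z *: box_poly x))|%N == 1%N]|
    <= (2 * D.+1) * Y ^ D)%N.
Proof.
move=> Q0; set S := [set x | _].
pose tail (x : {ffun 'I_D.+1 -> 'I_Y}) : {ffun 'I_D -> 'I_Y} :=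
  [ffun i => x (lift ord0 i)].
rewrite -sum1_card (partition_big tail predT) //=.
apply: (@leq_trans (\sum_(j : {ffun 'I_D -> 'I_Y}) 2 * D.+1)%N); last first.
  by rewrite sum_nat_const card_ffun !card_ord mulnC.
apply: leq_sum => y _; rewrite sum1dep_card.
set F := [set x in S | _].
have [-> |[x1 x1F]] := set_0Vmem F; first by rewrite cards0.
(* [h] is the part without constant term, common to the whole fibre. *)
pose h := box_poly x1 - (x1 ord0 : nat)%:Z%:P.
have bpE x : x \in F -> box_poly x = h + (x ord0 : nat)%:Z%:P.
  rewrite /F inE => /andP[_ /eqP xy].
  move: x1F; rewrite inE => /andP[_ /eqP x1y].
  apply/polyP => i; rewrite !coefE; case: ltnP => iD; last first.
    by case: i iD => //= i _; rewrite subr0 addr0.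
  case: i iD => [|i] iD; first by
    rewrite (_ : inord 0 = ord0) /= ?subrr ?add0r //; apply: val_inj; rewrite /= inordK.
  rewrite /= subr0 addr0.
  have Ei : (inord i.+1 : 'I_D.+1) = lift ord0 (Ordinal (iD : (i < D)%N)).
    by apply: val_inj; rewrite /= inordK.
  have : tail x (Ordinal (iD : (i < D)%N)) = tail x1 (Ordinal (iD : (i < D)%N)).
    by rewrite xy x1y.
  by rewrite !ffunE Ei => ->.
pose A := horner_mx C (1 + Q%:Z *: h).
have detE x : x \in F -> \det (horner_mx C (1 + Q%:Z *: box_poly x)) =
    \det ((Q%:Z * (x ord0 : nat)%:Z)%:M + A).
  move=> xF; rewrite (bpE _ xF) scalerDr addrA addrC rmorphD /=.
  by rewrite -[_ *: _%:P]mul_polyC -polyCM horner_mx_C.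
have inj : {in F &, injective (fun x : {ffun 'I_D.+1 -> 'I_Y} => x ord0)}.
  move=> a b aF bF ab; apply: box_poly_inj; rewrite (bpE _ aF) (bpE _ bF).
  by rewrite ab.
rewrite -(card_in_imset inj).
pose U (e : int) := [set x : 'I_Y | \det ((Q%:Z * (x : nat)%:Z)%:M + A) == e].
apply: leq_trans (_ : #|U 1%R :|: U (-1)%R| <= _)%N.
  apply: subset_leq_card; apply/fintype.subsetP => _ /imsetP[x xF ->].
  have : x \in S by move: xF; rewrite inE => /andP[].
  by rewrite !inE -(detE _ xF); case: (\det _) => [[|[|n]]|[|n]].
apply: leq_trans (leq_card_setU _ _) _.
by rewrite mul2n -addnn leq_add // det_shift_eq_card // eqz_nat -lt0n.
Qed.

(** Take the largest admissible cell side [t], so that [P <= K (2t)^(D+1)]. If [t <= Y], then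
    [(Y / t + 1) (2t) <= 4Y] gives the main term; if [t > Y], there is a single cell, whence the
    summand [D.+1 * P]. *)
Lemma box_bad_card_mul (D : nat) (C : 'M[int]_D.+1) (K Y Q q : nat) :
  (forall g : {poly int}, (size g <= D.+1)%N -> g != 0 -> \det (horner_mx C g) != 0) ->
  (forall (s : nat) (g : {poly int}),
    (size g <= D.+1)%N -> (forall i, (`|(g`_i)%R| <= s)%N) ->
    (`|\det (horner_mx C g)| <= K * s ^ D.+1)%N) ->
  (0 < K)%N -> prime q -> ~~ (q %| Q)%N -> (K < q)%N ->
  (#|[set x : {ffun 'I_D.+1 -> 'I_Y} |
       (q %| \det (horner_mx C (1 + Q%:Z *: box_poly x)))%Z]| * norm_step C q
    <= D.+1 * norm_step C q + D.+1 * 4 ^ D.+1 * K * Y ^ D.+1)%N.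
Proof.
move=> nz HK K0 pq qQ Kq; set P := norm_step C q.
have KP : (K < P)%N := leq_trans Kq (leq_norm_step C q).
have ex : exists t, (K * t ^ D.+1 < P)%N.
  by exists 1%N; rewrite exp1n muln1.
have bd t : (K * t ^ D.+1 < P)%N -> (t <= P)%N.
  move=> /ltnW; apply: leq_trans; case: t => // t.
  by rewrite expnS mulnCA leq_pmulr // muln_gt0 K0 expn_gt0.
case: (ex_maxnP ex bd) => t Ht maxt.
have t0 : (0 < t)%N by apply: maxt; rewrite exp1n muln1.
have Pt : (P <= K * (2 * t) ^ D.+1)%N.
  apply: leq_trans (_ : K * t.+1 ^ D.+1 <= _)%N.
    by rewrite leqNgt; apply/negP => /maxt; rewrite ltnn.
  by rewrite leq_mul2l leq_exp2r // (_ : t.+1 <= 2 * t)%N ?orbT //; lia.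
have := box_bad_card Y nz HK pq qQ t0 Ht.
move: #|_| => b bb; apply: leq_trans (leq_mul bb (leqnn P)) _.
have [tY|Yt] := leqP t Y; last first.
  by rewrite divn_small // exp1n muln1 leq_addr.
apply: leq_trans (leq_addl _ _); rewrite -!mulnA leq_mul2l; apply/orP; right.
apply: leq_trans (leq_mul (leqnn _) Pt) _.
rewrite mulnCA -expnMn [X in (_ <= X)%N]mulnCA -expnMn leq_mul2l leq_exp2r //.
apply/orP; right; have := leq_trunc_div Y t; lia.
Qed.

(** An element whose norm is not 1 or -1 is caught by the least prime factor [q] of its norm:
    [q > z] because the element is 1 modulo every prime up to [z], and [norm_step C q] divides a
    nonzero norm of size at most [X]. *)
Lemma box_cover (D : nat) (C : 'M[int]_D.+1) (K Y z X : nat) :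
  (forall (s : nat) (g : {poly int}),
    (size g <= D.+1)%N -> (forall i, (`|(g`_i)%R| <= s)%N) ->
    (`|\det (horner_mx C g)| <= K * s ^ D.+1)%N) ->
  (1 < z)%N -> X = (K * (z`! * Y) ^ D.+1)%N ->
  (Y ^ D.+1 <= 2 * D.+1 * Y ^ D +
    \sum_(z.+1 <= q < X.+1 | prime q && (norm_step C q <= X))
      #|[set x : {ffun 'I_D.+1 -> 'I_Y} |
       (q %| \det (horner_mx C (1 + (z`!)%:Z *: box_poly x)))%Z]|)%N.
Proof.
move=> HK z1; set Q := z`! => XE.
have Q0 : (0 < Q)%N by exact: fact_gt0.
apply: leq_trans (leq_add (box_unit_card C Y Q0) (leqnn _)).
have -> : (Y ^ D.+1)%N = #|[set: {ffun 'I_D.+1 -> 'I_Y}]|.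
  by rewrite cardsT card_ffun !card_ord.
rewrite -!sum1_card [X in (X <= _)%N]big_mkcond /= [X in (_ <= X + _)%N]big_mkcond /=.
under [X in (_ <= _ + X)%N]eq_bigr => q _ do rewrite -sum1_card big_mkcond /=.
rewrite exchange_big /= -big_split /=; apply: leq_sum => x _.
rewrite !inE; case: eqP => //= /eqP N1.
set N := \det _ in N1 *.
have Ndvd q : prime q -> (q %| Q)%N -> ~~ (q %| N)%Z.
  move=> pq qQ; rewrite dvdz_det_unitmx // negbK map_horner_mx rmorphD rmorph1 /=.
  rewrite map_polyZ /= (_ : Q%:Z%:~R = 0) ?scale0r ?addr0 ?rmorph1 ?unitmx1 //.
  by apply/eqP; rewrite intr_Fp_eq0.
(* Since 2 divides [z!], the norm is odd, hence nonzero. *)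
have N0 : (0 < `|N|)%N.
  rewrite absz_gt0; apply/eqP => N0.
  by have /negP := Ndvd 2 isT (dvdn_fact (z1 : 0 < 2 <= z)%N); rewrite N0 dvdz0.
pose q := pdiv `|N|.
have pq : prime q by apply: pdiv_prime; rewrite ltn_neqAle eq_sym N1.
have qN : (q %| N)%Z by exact: pdiv_dvd.
have zq : (z < q)%N.
  rewrite ltnNge; apply/negP => qz; have := Ndvd q pq.
  by rewrite qN dvdn_fact ?prime_gt0 // => /(_ isT).
have PX : (norm_step C q <= X)%N.
  apply: leq_trans (dvdn_leq N0 (norm_step_dvdz pq qN)) _.
  rewrite XE; apply: HK => [|i].
    rewrite (leq_trans (size_polyD _ _)) // geq_max size_poly1 /=.
    by rewrite (leq_trans (size_scale_leq _ _)) // size_box_poly.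
  rewrite coefD coefZ coef1; case: (ltnP i D.+1) => iD; last first.
    by rewrite nth_default ?(leq_trans (size_box_poly _)) // mulr0 addr0; case: i iD.
  rewrite -[i]/(nat_of_ord (Ordinal iD)) !coef_box_poly.
  move: (x _) => [a /= aY]; rewrite -PoszM natz -PoszD absz_nat.
  apply: leq_trans (_ : Q + Q * a <= _)%N; last by rewrite -mulnS leq_mul2l aY orbT.
  by rewrite leq_add2r; case: (i == _).
rewrite (big_rem q) /=; last first.
  by rewrite mem_index_iota zq ltnS (leq_trans (leq_norm_step C q)).
by rewrite pq PX inE qN.
Qed.

(** * Divergence of the sum of inverses over primes with a root *)

(** If no tail stayed below [e], gluing successive blocks would give partial sums above every
    multiple of [e]. *)
Lemma bounded_series_tail (u : nat -> rat) (M : rat) :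
  (forall i, 0 <= u i) -> (forall N, \sum_(0 <= i < N) u i <= M) ->
  forall e, 0 < e -> exists z, forall N, \sum_(z <= i < N) u i <= e.
Proof.
move=> u0 uM e e0; apply: contrapT => Hz.
have {Hz} step z : exists2 N, (z <= N)%N & e < \sum_(z <= i < N) u i.
  apply: contrapT => H; apply: Hz; exists z => N; rewrite leNgt; apply/negP => eN.
  apply: H; exists N => //; rewrite leqNgt; apply/negP => Nz.
  by move: eN; rewrite big_geq ?(ltnW Nz) // ltNge (ltW e0).
have big k : exists N, e *+ k <= \sum_(0 <= i < N) u i.
  elim: k => [|k [N HN]]; first by exists 0%N; rewrite big_geq.
  have [N' NN' HN'] := step N; exists N'.
  by rewrite (big_cat_nat (n := N)) //= mulrSr lerD // ltW.
have [N] := big (Num.bound `|M / e|).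
apply/negP; rewrite -ltNge; apply: le_lt_trans (uM N) _.
rewrite -mulr_natl -ltr_pdivrMr //; apply: le_lt_trans (ler_norm _) _.
exact: archi_boundP (normr_ge0 _).
Qed.

Lemma sum_inv_sqr_le (N : nat) : \sum_(0 <= i < N) (i ^ 2)%:R^-1 <= 2 :> rat.
Proof.
case: N => [|N]; first by rewrite big_geq.
(* This sharper bound telescopes; as [0^-1 = 0], the term [i = 0] vanishes. *)
suff : \sum_(0 <= i < N.+1) (i ^ 2)%:R^-1 <= 2 - (N%:R)^-1 :> rat.
  by move=> /le_trans; apply; rewrite gerBl invr_ge0.
elim: N => [|[|N] IH].
- by rewrite big_nat1.
- by rewrite !big_nat_recr //= big_geq.
rewrite big_nat_recr //=; apply: le_trans (lerD IH (lexx _)) _.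
have a0 : 0 < N.+1%:R :> rat by [].
have b0 : 0 < N.+2%:R :> rat by [].
rewrite -subr_ge0 natrX.
have -> : 2 - N.+2%:R^-1 - (2 - N.+1%:R^-1 + (N.+2%:R ^+ 2)^-1) =
   (N.+1%:R * N.+2%:R ^+ 2)^-1 :> rat.
  move: a0 b0; rewrite -[N.+2%:R]natr1; move: (N.+1%:R : rat) => x a0 b0.
  by field; rewrite !gt_eqF.
by rewrite invr_ge0 mulr_ge0 // exprn_ge0.
Qed.

Lemma sum_nat_widenl_le (u : nat -> rat) (a b N : nat) : (forall i, 0 <= u i) ->
  (a <= b)%N -> \sum_(b <= i < N) u i <= \sum_(a <= i < N) u i.
Proof.
move=> u0 ab; have [bN|Nb] := leqP b N; last first.
  by rewrite big_geq ?(ltnW Nb) // sumr_ge0.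
by rewrite (big_cat_nat (n := b) (m := a)) //= lerDr sumr_ge0.
Qed.

Lemma prime_dvd_fact (q n : nat) : prime q -> (q %| n`!)%N -> (q <= n)%N.
Proof.
move=> pq; elim: n => [|n IH].
  by rewrite dvdn1 => /eqP q1; rewrite q1 in pq.
by rewrite factS Euclid_dvdM // => /orP[/dvdn_leq|/IH/leqW]; first exact.
Qed.

(** Indices below [w] are counted trivially, and each later one has weight [X * u q >= 1]. A small
    tail of [u] thus makes the count small compared with [X]. *)
Lemma count_le_weight (c : pred nat) (u : nat -> rat) (X : rat) (w n : nat) :
  (forall i, 0 <= u i) -> 0 <= X -> (forall q, c q -> 1 <= X * u q) ->
  \sum_(0 <= q < n | c q) 1 <= w%:R + X * \sum_(w <= q < n) u q.
Proof.
move=> u0 X0 cu.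
have le_n k : \sum_(0 <= q < k | c q) 1 <= k%:R :> rat.
  apply: le_trans (_ : \sum_(0 <= q < k) (1 : rat) <= _).
    by rewrite big_mkcond /=; apply: ler_sum => i _; case: (c i).
  by rewrite sumr_const_nat subn0.
have [wn|nw] := leqP w n; last first.
  rewrite [X in _ + _ * X]big_geq ?(ltnW nw) // mulr0 addr0 (le_trans (le_n _)) //.
  by rewrite ler_nat ltnW.
rewrite (big_cat_nat (n := w)) //= lerD //.
rewrite mulr_sumr big_mkcond /=; apply: ler_sum => i _.
by case: ifP => [/cu //|_]; rewrite mulr_ge0.
Qed.

(* Sieving the box [1 + z! * [0, Y)^d] by the primes above [z] would leave at
   least a quarter of it; but what is left has norm 1 or -1. *)
Lemma sum_inv_norm_step_unbounded (D : nat) (C : 'M[int]_D.+1) :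
  (forall g : {poly int}, (size g <= D.+1)%N -> g != 0 -> \det (horner_mx C g) != 0) ->
  forall M : rat, exists N, M < \sum_(0 <= q < N | prime q) (norm_step C q)%:R^-1.
Proof.
move=> nz M; apply: contrapT => H.
pose u q : rat := if prime q then (norm_step C q)%:R^-1 else 0.
have u0 i : 0 <= u i by rewrite /u; case: ifP => // _; rewrite invr_ge0.
have uM N : \sum_(0 <= q < N) u q <= M.
  rewrite /u -big_mkcond leNgt; apply/negP => HN; apply: H; by exists N.
have tail := bounded_series_tail u0 uM.
have [K [K0 HK]] := norm_horner_mx_bound C.
pose d := D.+1; pose K1 := (d * 4 ^ d * K)%N.
have K1p : 0 < K1%:R :> rat by rewrite ltr0n !muln_gt0 K0 expn_gt0.
have [|z0 Hz0] := tail (4 * K1%:R)^-1; first by rewrite invr_gt0 mulr_gt0.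
(* Primes above [z] exceed [K], as [box_bad_card_mul] requires, and their weights sum to at most
   [1 / (4 K1)], so its main terms total at most a quarter of the box. *)
pose z := maxn 2 (maxn K z0).
have z1 : (1 < z)%N by rewrite leq_maxl.
have Hz N : \sum_(z.+1 <= q < N) u q <= (4 * K1%:R)^-1.
  apply: le_trans (Hz0 N); apply: sum_nat_widenl_le => //.
  by rewrite ltnW // ltnS !leq_max leqnn !orbT.
(* With [X = K (Q Y)^d], a tail of at most [1 / (4 KQ)] beyond [w] bounds the total of the summands
   [d] by [d w + Y^d / 4]. *)
pose Q := z`!; pose KQ := (d * K * Q ^ d)%N.
have KQp : 0 < KQ%:R :> rat by rewrite ltr0n !muln_gt0 K0 expn_gt0 fact_gt0.
have [|w Hw] := tail (4 * KQ%:R)^-1; first by rewrite invr_gt0 mulr_gt0.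
(* [w] depends on [z] but not on [Y], so [Y] may be chosen last, with [4 d Y^D + 2 d w < Y^d]. *)
pose Y := (4 * d + 2 * d * w).+1.
pose X := (K * (Q * Y) ^ d)%N.
have cov : (Y ^ D.+1 <= _)%N := box_cover (Y := Y) (X := X) HK z1 erefl.
have {cov} : (Y ^ d)%:R <= (2 * d * Y ^ D)%:R +
    \sum_(z.+1 <= q < X.+1 | prime q && (norm_step C q <= X)%N)
      (d%:R + K1%:R * (Y ^ d)%:R * u q).
  move: cov; rewrite -(ler_nat rat) => /le_trans; apply.
  rewrite natrD lerD2l natr_sum.
  rewrite big_nat_cond [X in _ <= X]big_nat_cond.
  apply: ler_sum => q /andP[/andP[zq _] /andP[pq PX]].
  have P0 : 0 < (norm_step C q)%:R :> rat.
    by rewrite ltr0n (leq_trans (prime_gt0 pq)) // leq_norm_step.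
  rewrite -(ler_pM2r P0) /u pq mulrDl mulfVK ?gt_eqF // -!natrM -natrD ler_nat.
  apply: box_bad_card_mul => //.
    apply/negP => /(prime_dvd_fact pq); by rewrite leqNgt zq.
  by apply: leq_ltn_trans zq; rewrite !leq_max leqnn orbT.
apply/negP; rewrite -ltNge.
set S := \sum_(_ <= q < _ | _) _.
have S1 : S <= d%:R * (w%:R + X%:R * (4 * KQ%:R)^-1) +
     K1%:R * (Y ^ d)%:R * (4 * K1%:R)^-1.
  rewrite /S big_split /=; apply: lerD.
    rewrite -[X in \sum_(_ <= _ < _ | _) X]mulr1 -mulr_sumr ler_pM2l ?ltr0n //.
    apply: le_trans (_ : \sum_(0 <= q < X.+1 | prime q && (norm_step C q <= X)%N) 1 <= _).
      rewrite big_mkcond [X in _ <= X]big_mkcond; apply: sum_nat_widenl_le => // i.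
      by case: ifP.
    apply: le_trans (count_le_weight (X := X%:R) w X.+1 u0 _ _) _ => //.
      move=> q /andP[pq PX]; rewrite /u pq.
      have P0 : 0 < (norm_step C q)%:R :> rat.
        by rewrite ltr0n (leq_trans (prime_gt0 pq)) // leq_norm_step.
      by rewrite ler_pdivlMr // mul1r ler_nat.
    by rewrite lerD2l ler_wpM2l.
  rewrite -mulr_sumr ler_wpM2l ?mulr_ge0 //.
  apply: le_trans (Hz X.+1); rewrite big_mkcond; apply: ler_sum => i _.
  by case: ifP.
apply: le_lt_trans (_ : (2 * d * Y ^ D)%:R + (d%:R * w%:R + (Y ^ d)%:R / 2) < _).
  rewrite lerD2l; apply: le_trans S1 _.
  have E1 : d%:R * (X%:R * (4 * KQ%:R)^-1) = (Y ^ d)%:R / 4 :> rat.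
    have -> : X%:R = KQ%:R / d%:R * (Y ^ d)%:R :> rat.
      rewrite /X /KQ expnMn !natrM; by field; rewrite pnatr_eq0.
    by field; rewrite gt_eqF //= pnatr_eq0.
  have E2 : K1%:R * (Y ^ d)%:R * (4 * K1%:R)^-1 = (Y ^ d)%:R / 4 :> rat.
    by field; rewrite gt_eqF.
  rewrite mulrDr E1 E2; lra.
have : (4 * d * Y ^ D + 2 * d * w < Y ^ d)%N.
  rewrite /d expnS; apply: leq_ltn_trans (_ : (4 * d + 2 * d * w) * Y ^ D < _)%N.
    by rewrite mulnDl leq_add2l leq_pmulr // expn_gt0.
  by rewrite ltn_mul2r expn_gt0 /= /Y.
rewrite -(ltr_nat rat) natrD !natrM; lra.
Qed.

(** A prime without a root contributes [1 / q^2]; together these give at most 2. *)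
Lemma sum_inv_root_mod_unbounded (D : nat) (C : 'M[int]_D.+1) :
  (forall g : {poly int}, (size g <= D.+1)%N -> g != 0 -> \det (horner_mx C g) != 0) ->
  forall M : rat, exists N, M < \sum_(0 <= q < N | prime q && root_mod C q) q%:R^-1.
Proof.
move=> nz M; have [N HN] := sum_inv_norm_step_unbounded nz (M + 2); exists N.
suff : \sum_(0 <= q < N | prime q) (norm_step C q)%:R^-1 <=
   \sum_(0 <= q < N | prime q && root_mod C q) q%:R^-1 + 2 :> rat by lra.
apply: le_trans (lerD (lexx _) (sum_inv_sqr_le N)).
rewrite big_mkcond [X in _ <= X + _]big_mkcond -big_split /=.
apply: ler_sum => q _; rewrite /norm_step; case: (prime q) => /=; last first.
  by rewrite add0r invr_ge0.
by case: (root_mod C q); rewrite ?add0r // lerDl invr_ge0.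
Qed.

(** * Primes congruent to 1 *)

Lemma char_poly_surj (R : comNzRingType) (D : nat) (f : {poly R}) :
  f \is monic -> size f = D.+2 -> exists C : 'M[R]_D.+1, char_poly C = f.
Proof.
move=> fm sf; have := companionmxK fm; move: (companionmx f).
by rewrite sf => C EC; exists C.
Qed.

(** A common root of [g] and ['Phi_n] would be a primitive [n]-th root of unity, whose minimal
    polynomial over the rationals has degree [D.+1], too large to divide [g]. *)
Lemma det_horner_mx_Cyclotomic_neq0 (n D : nat) (C : 'M[int]_D.+1) (g : {poly int}) :
  (0 < n)%N -> char_poly C = 'Phi_n -> (size g <= D.+1)%N -> g != 0 ->
  \det (horner_mx C g) != 0.
Proof.
move=> n0 EC sg g0.
have sPhi : (totient n).+1 = D.+2 by rewrite -size_Cyclotomic -EC size_char_poly.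
pose CC : 'M[algC]_D.+1 := map_mx intr C.
suff : horner_mx CC (map_poly intr g) \in unitmx.
  by rewrite -map_horner_mx unitmxE det_map_mx unitfE intr_eq0.
rewrite horner_mx_unitE coprimep_sym.
apply: (coprimep_dvdr (p := char_poly CC)).
  exact: mxminpoly_dvd_char.
have [z0 prim_z0] := C_prim_root_exists n0.
have -> : char_poly CC = cyclotomic z0 n.
  by rewrite -map_char_poly EC (Cintr_Cyclotomic prim_z0).
apply/Pdiv.ClosedField.coprimepP => z; rewrite root_cyclotomic // => prim_z.
have [p [Ep mp Hp]] := minCpolyP z.
have -> : map_poly intr g = map_poly ratr (map_poly intr g) :> {poly algC}.
  by rewrite -map_poly_comp; apply: eq_map_poly => x /=; rewrite ratr_int.
rewrite -[_ != 0]/(~~ root _ _) Hp; apply/negP => /dvdp_leq.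
rewrite map_poly_eq0_id0 ?intr_eq0 ?lead_coef_eq0 // => /(_ g0).
have -> : size p = D.+2.
  rewrite -(size_map_poly (ratr : rat -> algC)) -Ep.
  by rewrite (minCpoly_cyclotomic prim_z) size_cyclotomic.
rewrite size_map_poly_id0 ?intr_eq0 ?lead_coef_eq0 //.
by rewrite leqNgt ltnS sg.
Qed.

(** The order [m] of [r] divides [n]. If [m != n], then [r] is also a root of some ['Phi_e] with [e]
    dividing [m], hence a double root of [X^n - 1], which is separable because [n] is nonzero in
    [F]. *)
Lemma root_Cyclotomic_prim (F : fieldType) (n : nat) (r : F) :
  (0 < n)%N -> n%:R != 0 :> F -> root (map_poly intr 'Phi_n) r -> n.-primitive_root r.
Proof.
move=> n0 nF rr.
have fact k : (0 < k)%N ->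
    'X^k - 1 = \prod_(d <- divisors k) map_poly intr 'Phi_d :> {poly F}.
  move=> k0; have := congr1 (map_poly (intr : int -> F)) (prod_Cyclotomic k0).
  by rewrite rmorphB rmorph1 rmorph_prod /= map_polyXn => <-.
have nn : n \in divisors n by rewrite -dvdn_divisors.
have rn : r ^+ n = 1.
  have : root ('X^n - 1) r by rewrite fact // (big_rem _ nn) /= rootM rr.
  by rewrite /root !hornerE subr_eq0 => /eqP.
have [m prim_m mn] := prim_order_exists n0 rn.
have m0 := prim_order_gt0 prim_m.
have [<- //|m_n] := eqVneq m n.
have : \prod_(d <- divisors m) (map_poly intr 'Phi_d : {poly F}).[r] = 0.
  rewrite -horner_prod -fact // !hornerE (prim_expr_order prim_m); exact: subrr.
move/eqP; rewrite prodf_seq_eq0 => /hasP[e /= em re].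
have e_n : e != n.
  apply: contraNneq m_n => E; rewrite -dvdn_divisors // in em.
  by rewrite eqn_dvd mn -E em.
have en : e \in rem n (divisors n).
  rewrite mem_rem_uniq ?divisors_uniq // inE e_n /= -dvdn_divisors //.
  by apply: dvdn_trans mn; rewrite dvdn_divisors.
have := separable_Xn_sub_1 nF; rewrite fact // (big_rem _ nn) /= separable_mul.
case/and3P => _ _ /coprimep_root /(_ rr).
by rewrite (big_rem _ en) /= hornerM (eqP re) mul0r eqxx.
Qed.

Lemma root_mod_Cyclotomic (n D q : nat) (C : 'M[int]_D.+1) :
  (0 < n)%N -> char_poly C = 'Phi_n -> prime q -> ~~ (q %| n)%N ->
  root_mod C q -> (n %| q.-1)%N.
Proof.
move=> n0 EC pq qn /existsP[r]; rewrite -map_char_poly EC => rr.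
have prim_r : n.-primitive_root r.
  by apply: root_Cyclotomic_prim rr => //; rewrite -(dvdn_pcharf (pchar_Fp pq)).
rewrite (prim_order_dvd prim_r); have r0 : r != 0.
  apply/eqP => r0; have := prim_expr_order prim_r; rewrite r0 expr0n.
  by rewrite gtn_eqF // => /eqP; rewrite eq_sym oner_eq0.
apply/eqP/(mulfI r0); rewrite mulr1 -exprS prednK ?prime_gt0 //.
by have := expf_card r; rewrite card_Fp.
Qed.

Lemma sum_inv_primes_1mod_unbounded (n : nat) (M : rat) : (0 < n)%N ->
  exists N, M < \sum_(0 <= q < N | prime q && (n %| q.-1)%N) q%:R^-1.
Proof.
move=> n0; have : size 'Phi_n = (totient n).-1.+2.
  by rewrite size_Cyclotomic prednK // totient_gt0.
case/(char_poly_surj (Cyclotomic_monic n)) => C EC.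
have [N HN] := sum_inv_root_mod_unbounded
  (fun g => det_horner_mx_Cyclotomic_neq0 (g := g) n0 EC) (M + n.+1%:R).
exists N; rewrite -(ltrD2r n.+1%:R); apply: lt_le_trans HN _.
(* The primes dividing [n], to which [root_mod_Cyclotomic] does not apply, cost at most [n.+1] in
   all. *)
pose v q : rat := (q %| n)%N%:R.
have Hv : \sum_(0 <= q < N | (q %| n)%N) 1 <= n.+1%:R :> rat.
  have v0 : \sum_(n.+1 <= q < N) v q = 0.
    by rewrite big_nat big1 // => q /andP[nq _]; rewrite /v gtnNdvd.
  rewrite -[X in _ <= X]addr0 -[X in _ <= _ + X](mulr0 1) -[X in 1 * X]v0.
  apply: count_le_weight => // q qn.
  by rewrite /v qn mulr1.
apply: le_trans (lerD (lexx _) Hv).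
rewrite big_mkcond [X in _ <= X + _]big_mkcond [X in _ <= _ + X]big_mkcond -big_split /=.
apply: ler_sum => q _; case: ifP => [/andP[pq rq]|_]; last first.
  by apply: addr_ge0; case: ifP => // _; rewrite invr_ge0.
rewrite pq /=; have [qn|qn] := boolP (q %| n)%N.
  apply: le_trans (_ : 1 <= _); last first.
    by rewrite lerDr; case: ifP => // _; rewrite invr_ge0.
  by rewrite invf_le1 ?ler1n ?ltr0n ?prime_gt0.
by rewrite (root_mod_Cyclotomic n0 EC) // addr0.
Qed.

(** The product of the factors [q / (q - 1)] is at least [1] plus the sum of the [1 / q], which is
    unbounded. *)
Lemma exists_primes_1mod (n k : nat) : (0 < n)%N ->
  exists s : seq nat, [/\ uniq s, all (fun q => prime q && (n %| q.-1))%N s &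
    (k * \prod_(q <- s) q.-1 <= \prod_(q <- s) q)%N].
Proof.
move=> n0; have [N HN] := sum_inv_primes_1mod_unbounded k%:R n0.
pose s := [seq q <- index_iota 0 N | prime q && (n %| q.-1)%N].
have sP : all (fun q => prime q && (n %| q.-1))%N s by exact: filter_all.
exists s; split=> //; first by rewrite filter_uniq // iota_uniq.
have {}HN : k%:R < \sum_(q <- s) q%:R^-1 :> rat by rewrite big_filter.
rewrite -(ler_nat rat) natrM.
apply: le_trans (_ : (1 + \sum_(q <- s) q%:R^-1) * (\prod_(q <- s) q.-1)%:R <= _).
  by rewrite ler_wpM2r //; lra.
elim: s sP {HN} => [|q s IH] /=; first by rewrite !big_nil mulr1 addr0.
move=> /andP[/andP[pq _] /IH {}IH]; rewrite !big_cons !natrM.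
have q1 : 1 <= q%:R :> rat by rewrite ler1n prime_gt0.
have -> : q.-1%:R = q%:R - 1 :> rat by rewrite -subn1 natrB // prime_gt0.
apply: le_trans (_ : q%:R * ((1 + \sum_(j <- s) j%:R^-1) *
  (\prod_(j <- s) j.-1)%:R) <= _); last by rewrite ler_wpM2l.
rewrite mulrA [X in _ <= X]mulrA ler_wpM2r //.
have S0 : 0 <= \sum_(j <- s) j%:R^-1 :> rat.
  by rewrite sumr_ge0 // => i _; rewrite invr_ge0.
have qV : q%:R^-1 * q%:R = 1 :> rat by rewrite mulVf // gt_eqF //; lra.
have qV0 : 0 <= q%:R^-1 :> rat by rewrite invr_ge0.
nra.
Qed.

Local Close Scope ring_scope.

(** * Sets of density zero *)

Lemma totient_prod_primes (s : seq nat) : uniq s -> all prime s ->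
  totient (\prod_(q <- s) q) = \prod_(q <- s) q.-1.
Proof.
elim: s => [|q s IH] /=; first by rewrite !big_nil.
move=> /andP[qs us] /andP[pq ps]; rewrite !big_cons totient_coprime.
  by rewrite totient_prime // IH.
rewrite coprime_sym big_seq.
apply: (big_ind (fun x => coprime x q)) => [|x y cx cy|x xs].
- exact: coprime1n.
- by rewrite coprimeMl cx.
have px := allP ps x xs; rewrite prime_coprime // dvdn_prime2 //.
by apply: contraNneq qs => <-.
Qed.

Lemma count_iota_sum (P : pred nat) (m n : nat) :
  count P (iota m n) = \sum_(m <= i < m + n) P i.
Proof. by rewrite /index_iota addKn -sumn_count sumnE big_map. Qed.

Lemma sum_coprime_periods (A j : nat) :
  \sum_(0 <= i < A * j) coprime A i = j * totient A.
Proof.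
elim: j => [|j IH]; first by rewrite muln0 big_geq.
rewrite mulnS addnC (big_cat_nat (n := A * j)) ?leq_addr //= IH mulSn addnC.
congr (_ + _).
rewrite -{1}[A * j]add0n big_addn addKn totient_count_coprime.
by apply: eq_bigr => i _; rewrite /coprime addnC mulnC gcdnMDl.
Qed.

Definition density0 (P : pred nat) : Prop :=
  forall k, exists N0, forall N, N0 <= N -> k * count P (iota 1 N) <= N.

(** Such an [m] is coprime to the product [A] of suitable primes [q = 1 mod n], and the proportion
    [totient A / A] can be made arbitrarily small. *)
Lemma density0_no_prime_1mod (n : nat) : 0 < n ->
  density0 (fun m => all (fun q => ~~ (n %| q.-1)) (primes m)).
Proof.
(* The factor 2 pays for the last, incomplete period, as [N >= A]. *)
move=> n0 k; have [s [us /allP ps Hs]] := exists_primes_1mod (2 * k) n0.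
pose A := \prod_(q <- s) q.
have ps' : all prime s by apply/allP => q /ps /andP[].
have tA : totient A = \prod_(q <- s) q.-1 by exact: totient_prod_primes.
have A0 : 0 < A by rewrite /A big_seq; apply: prodn_cond_gt0 => q /ps /andP[/prime_gt0].
exists A => N AN; set c := count _ _.
have cle : c <= (N %/ A).+1 * totient A.
  rewrite -sum_coprime_periods /c count_iota_sum.
  apply: (@leq_trans (\sum_(0 <= i < N.+1) coprime A i)).
    rewrite add1n [X in _ <= X]big_ltn // big_nat [X in _ <= _ + X]big_nat.
    apply: leq_trans (leq_addl _ _); apply: leq_sum => m /andP[m0 _].
    case: allP => //= H; rewrite (_ : coprime A m) //.
    rewrite /A big_seq; apply: (big_ind (fun x => coprime x m)) => [|x y cx cy|q qs].
    - exact: coprime1n.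
    - by rewrite coprimeMl cx.
    case/andP: (ps _ qs) => pq nq; rewrite prime_coprime //; apply/negP => qm.
    by have := H q; rewrite mem_primes pq m0 qm nq => /(_ isT).
  rewrite [X in _ <= X](big_cat_nat (n := N.+1)) ?leq_addr //=.
  by rewrite mulnC ltn_ceil.
have : 2 * k * c <= 2 * N; last by lia.
apply: leq_trans (leq_mul (leqnn _) cle) _.
rewrite mulnCA tA; apply: leq_trans (leq_mul (leqnn _) Hs) _.
rewrite -/A mulSn; have := leq_trunc_div N A; lia.
Qed.

Lemma density0_finite_family (Q : nat -> pred nat) (z K : nat) :
  (forall p, p <= z -> density0 (Q p)) ->
  exists N0, forall N p, N0 <= N -> p <= z -> K * count (Q p) (iota 1 N) <= N.
Proof.
elim: z => [|z IH] HQ.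
  have [N0 H] := HQ 0 isT K; exists N0 => N p NN; rewrite leqn0 => /eqP ->; exact: H.
have [|N1 H1] := IH; first by move=> p pz; apply: HQ; exact: leqW.
have [N2 H2] := HQ z.+1 (leqnn _) K.
exists (maxn N1 N2) => N p; rewrite geq_max => /andP[n1 n2].
by rewrite leq_eqVlt => /orP[/eqP ->|pz]; [exact: H2 | exact: H1].
Qed.

Lemma count_union_le (P : pred nat) (Q : nat -> pred nat) (r : seq nat) (N : nat) :
  (forall m, 0 < m <= N -> P m -> exists2 i, i \in r & Q i m) ->
  count P (iota 1 N) <= \sum_(i <- r) count (Q i) (iota 1 N).
Proof.
move=> H; rewrite count_iota_sum.
under [X in _ <= X]eq_bigr do rewrite count_iota_sum.
rewrite exchange_big /= big_nat [X in _ <= X]big_nat; apply: leq_sum => m.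
rewrite add1n ltnS => mN; case Pm: (P m) => //.
have [i ir Qi] := H m mN Pm.
by rewrite (big_rem i) //= Qi.
Qed.

Lemma count_dvdn_iota (d N : nat) : count (fun m => d %| m) (iota 1 N) = N %/ d.
Proof. by rewrite count_iota_sum add1n divn_count_dvd. Qed.

(** Telescoping, from [1 / p^2 <= 1 / (p - 1) - 1 / p]. This handles the integers divisible by [p^2]
    for some [p > z]. *)
Lemma sum_div_sqr_le (z N : nat) : 0 < z ->
  z * \sum_(z.+1 <= p < N.+1) N %/ p ^ 2 <= N.
Proof.
move=> z0; suff H M : (\sum_(z.+1 <= p < M) (p ^ 2)%:R^-1 <= z%:R^-1 :> rat)%R.
  have zp : (0 < z%:R :> rat)%R by rewrite ltr0n.
  rewrite -(ler_nat rat) natrM mulrC -ler_pdivlMr // natr_sum.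
  apply: le_trans (_ : N%:R * \sum_(z.+1 <= p < N.+1) (p ^ 2)%:R^-1 <= _)%R; last first.
    by rewrite ler_wpM2l.
  rewrite mulr_sumr big_nat [X in (_ <= X)%R]big_nat; apply: ler_sum => p /andP[zp' _].
  have p0 : 0 < p ^ 2 by rewrite expn_gt0 (leq_trans _ zp').
  by rewrite ler_pdivlMr ?ltr0n // -natrM ler_nat leq_trunc_div.
have [Mz|zM] := leqP M z.+1; first by rewrite big_geq // invr_ge0.
suff Hk k : (\sum_(z.+1 <= p < z.+1 + k) (p ^ 2)%:R^-1 <=
    z%:R^-1 - (z + k)%:R^-1 :> rat)%R.
  rewrite -(subnKC (ltnW zM)); apply: le_trans (Hk _) _.
  by rewrite gerBl invr_ge0.
elim: k => [|k IH]; first by rewrite !addn0 big_geq // subrr.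
rewrite addnS big_nat_recr ?leq_addr //=; apply: le_trans (lerD IH (lexx _)) _.
rewrite -lerBrDl.
have z0R : (0 < z%:R :> rat)%R by rewrite ltr0n.
have x0 : (0 < (z + k)%:R :> rat)%R by rewrite ltr0n addn_gt0 z0.
rewrite addSn addnS natrX -[((z + k).+1%:R)%R]natr1; move: ((z + k)%:R)%R x0 => x x0.
rewrite -subr_ge0; set y := (X in (0 <= X)%R).
have -> : (y = (x * (x + 1) ^+ 2)^-1)%R.
  by rewrite /y; field; rewrite !gt_eqF //; lra.
by rewrite invr_ge0 mulr_ge0 ?exprn_ge0; lra.
Qed.

(** * The Carmichael function *)

Lemma prim_root_Fp (q : nat) : prime q -> exists g : 'F_q, (q.-1).-primitive_root%R g.
Proof.
move=> pq; pose rs := [seq x <- enum 'F_q | x != 0%R].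
have q1 : 0 < q.-1 by have := prime_gt1 pq; lia.
have : has (q.-1).-primitive_root%R rs.
  apply: has_prim_root => //.
  - apply/allP => x; rewrite mem_filter => /andP[x0 _]; rewrite unity_rootE.
    apply/eqP/(mulfI x0); rewrite mulr1 -exprS prednK ?prime_gt0 //.
    by have := expf_card x; rewrite card_Fp.
  - by rewrite filter_uniq // enum_uniq.
  rewrite size_filter -(leq_add2l 1) add1n prednK ?prime_gt0 //.
  rewrite -{1}(card_Fp pq) cardE -(count_predC (pred1 0%R)) leq_add2r.
  by rewrite count_uniq_mem ?enum_uniq // leq_b1.
by case/hasP => g _ pg; exists g.
Qed.

(** By the Chinese remainder theorem some unit [x] modulo [m] reduces to a primitive root modulo
    [q]; its power of exponent [carmichael m] is 1 modulo [m], hence modulo [q]. *)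
Lemma dvdn_carmichael (m q : nat) : 1 < m -> q \in primes m -> q.-1 %| carmichael m.
Proof.
move=> m1; rewrite mem_primes => /and3P[pq m0 qm].
have [g pg] := prim_root_Fp pq.
pose Q := m`_q; pose m' := m`_q^'.
have cop : coprime Q m' by exact: coprime_partC.
have QE : Q = q ^ logn q m by exact: p_part.
have qQ : q %| Q by rewrite QE -{1}(expn1 q) dvdn_exp2l // -pfactor_dvdn ?expn1.
pose x := chinese Q m' (g : nat) 1.
have g0 : g != 0%R.
  apply/eqP => g0; have := prim_expr_order pg; rewrite g0 expr0n.
  have : q.-1 != 0 by have := prime_gt1 pq; lia.
  by move=> /negbTE ->; move/eqP; rewrite eq_sym oner_eq0.
have xq : (x%:R = g :> 'F_q)%R.
  rewrite -[RHS]natr_Zp; apply: val_inj; rewrite /= !val_Fp_nat //.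
  rewrite -(modn_dvdm _ qQ) chinese_modl // modn_dvdm //.
have xm : coprime m x.
  rewrite -(partnC q m0) coprimeMl; apply/andP; split.
    rewrite -/Q QE coprimeXl // prime_coprime //.
    by rewrite (dvdn_pcharf (pchar_Fp pq)) xq.
  by rewrite -/m' -coprime_modr chinese_modr // coprime_modr coprimen1.
have ux : (x%:R : 'Z_m)%R \is a GRing.unit by rewrite unitZpE.
have := expg_exponent (finset.in_setT (FinRing.Unit ux)); rewrite -/(carmichael m).
move/(congr1 val); rewrite FinRing.val_unitX FinRing.val_unit1 /= -natrX.
move/(congr1 val); rewrite /= val_Zp_nat // => E.
rewrite (prim_order_dvd pg) -xq -natrX -[1%R]/(1%:R)%R.
apply/eqP/val_inj; rewrite /= !val_Fp_nat // -(modn_dvdm _ qm) E modn_dvdm.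
  by rewrite Fp_cast.
by rewrite Zp_cast.
Qed.

Lemma carmichael_dvdn (m : nat) : 0 < m -> carmichael m %| totient m.
Proof. by move=> m0; rewrite -card_units_Zp //; exact: exponent_dvdn. Qed.

Lemma prod_primes_logn (m : nat) : 0 < m -> \prod_(p <- primes m) p ^ logn p m = m.
Proof. by move=> m0; rewrite [RHS]prod_prime_decomp // prime_decompE big_map. Qed.

Lemma rad_mul (m : nat) : 0 < m ->
  rad m * \prod_(p <- primes m) p ^ (logn p m).-1 = m.
Proof.
move=> m0; rewrite -[RHS]prod_primes_logn // /rad -big_split /=.
apply: eq_big_seq => p; rewrite -logn_gt0 => l0.
by rewrite -expnS prednK.
Qed.

Lemma logn_rad (m p : nat) : p \in primes m -> logn p (rad m) = 1.
Proof.
move=> pm; have := pm; rewrite mem_primes => /and3P[pp _ _].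
rewrite /rad (big_rem p) //= lognM ?(prime_gt0 pp) //; last first.
  rewrite big_seq; apply: prodn_cond_gt0 => q /mem_rem.
  by rewrite mem_primes => /and3P[/prime_gt0].
rewrite -{1 2}(expn1 p) pfactorK // logn_coprime //.
rewrite coprime_sym big_seq; apply: (big_ind (fun x => coprime x p)).
- exact: coprime1n.
- by move=> x y cx cy; rewrite coprimeMl cx.
move=> x; rewrite mem_rem_uniq ?primes_uniq // inE => /andP[xp].
rewrite mem_primes => /and3P[px _ _]; rewrite prime_coprime // dvdn_prime2 //.
Qed.

Lemma totient_rad (m : nat) : totient (rad m) = \prod_(p <- primes m) p.-1.
Proof.
apply: totient_prod_primes; first exact: primes_uniq.
by apply/allP => p; rewrite mem_primes => /and3P[].
Qed.

Lemma dvdn_totient_rad (m q : nat) : q \in primes m -> q.-1 %| totient (rad m).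
Proof. by move=> qm; rewrite totient_rad (big_rem q) //= dvdn_mulr. Qed.

Lemma dvdn_from_logn (m n : nat) : 0 < m -> 0 < n ->
  (forall p, logn p m <= logn p n) -> m %| n.
Proof.
move=> m0 n0 H; apply/dvdn_partP => // p; rewrite mem_primes => /and3P[pp _ _].
by rewrite p_part pfactor_dvdn.
Qed.

(** With [e = m / rad m], [totient m = totient (rad m) * e], so [ffun m] is the gcd of [m] and
    [delta m * carmichael m / e]. The two gcds are compared prime by prime. *)
Lemma dfun_eq_ffun (m : nat) : 0 < m ->
  (forall p, prime p -> p ^ 2 %| m ->
    exists2 q, q \in primes m & p ^ (2 * logn p m).-1 %| q.-1) ->
  dfun m = ffun m.
Proof.
move=> m0 H; have [m1|m1] := leqP m 1.
  have -> : m = 1 by lia.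
  by rewrite /dfun /ffun !gcd1n.
set l := carmichael m; set t := totient (rad m).
pose e := \prod_(p <- primes m) p ^ (logn p m).-1.
have l0 : 0 < l by exact: exponent_gt0.
have rm0 : 0 < rad m.
  rewrite /rad big_seq; apply: prodn_cond_gt0 => q.
  by rewrite mem_primes => /and3P[/prime_gt0].
have t0 : 0 < t by rewrite totient_gt0.
have re : rad m * e = m by exact: rad_mul.
have e0 : 0 < e by move: m0; rewrite -re muln_gt0 => /andP[].
have d0 : 0 < delta m by rewrite /delta; case: ifP.
have te : totient m = t * e by rewrite totientE // /t totient_rad -big_split.
have loge p : logn p e = (logn p m).-1.
  have [pm|pm] := boolP (p \in primes m).
    by rewrite -{1}re lognM // logn_rad.
  have lm : logn p m = 0 by apply/eqP; rewrite -leqn0 leqNgt logn_gt0.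
  by apply/eqP; rewrite lm /= -leqn0 -lm dvdn_leq_log // -re dvdn_mull.
have Hp p : 1 < logn p m -> exists2 q, q \in primes m & p ^ (2 * logn p m).-1 %| q.-1.
  move=> lp; have : p \in primes m by rewrite -logn_gt0 ltnW.
  rewrite mem_primes => /and3P[pp _ _]; apply: H => //.
  by rewrite pfactor_dvdn.
have Hx p x : (forall q, q \in primes m -> q.-1 %| x) -> 0 < x -> 1 < logn p m ->
    (2 * logn p m).-1 <= logn p x.
  move=> Hx x0 lp; have [q qm pq] := Hp p lp.
  have : p \in primes m by rewrite -logn_gt0 ltnW.
  rewrite mem_primes => /and3P[pp _ _].
  by rewrite -pfactor_dvdn // (dvdn_trans pq) // Hx.
have Hl p := Hx p l (fun q qm => dvdn_carmichael m1 qm) l0.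
have Ht p := Hx p t (fun q qm => dvdn_totient_rad qm) t0.
have el : e %| l.
  apply: dvdn_from_logn => // p; rewrite loge.
  case: (logn p m) (Hl p) => [|[|a]] // /(_ isT); lia.
have -> : ffun m = gcdn m (delta m * l %/ e).
  by rewrite /ffun -/l -/t te -[t * e]mulnC divnMr.
have eL : e %| delta m * l by rewrite dvdn_mull.
have L0 : 0 < delta m * l %/ e by rewrite divn_gt0 // dvdn_leq // muln_gt0 d0.
apply: eqn_from_log; rewrite ?gcdn_gt0 ?m0 // => p.
rewrite !logn_gcd ?muln_gt0 ?d0 // logn_div // !lognM // loge.
(* Let [a] be the exponent of [p] in [m]. For [a = 0] both valuations vanish; [a = 1] is treated
   below; for [a >= 2] both are [a], since [(2a - 1) - (a - 1) = a]. *)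
case Em: (logn p m) (Hl p) (Ht p) => [|[|a]] Hlp Htp.
- by rewrite !min0n.
- have pm : p \in primes m by rewrite -logn_gt0 Em.
  have := pm; rewrite mem_primes => /and3P[pp _ _].
  have -> : logn p (delta m) = 0.
    rewrite /delta; case: ifP => [m4|_]; last by rewrite logn1.
    have [p2|p2] := eqVneq p 2.
      by move: Em m4; rewrite p2 -[4]/(2 ^ 2) pfactor_dvdn // => ->.
    by rewrite logn_coprime // prime_coprime // dvdn_prime2.
  (* Both valuations are capped at 1. If [p] divides some [q - 1], it divides [l]; conversely [l]
     divides [t * e], and [p] does not divide [e]. *)
  rewrite subn0 !add0n; suff : (0 < logn p t) = (0 < logn p l).
    by case: (logn p t) (logn p l) => [|x] [|y] //= _; lia.
  rewrite !logn_gt0 !mem_primes pp t0 l0 /=; apply/idP/idP => [|pl].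
    rewrite /t totient_rad Euclid_dvd_prod // big_has => /hasP[q qm pq].
    exact: dvdn_trans pq (dvdn_carmichael m1 qm).
  have : p %| t * e by rewrite -te (dvdn_trans pl) // carmichael_dvdn.
  rewrite Euclid_dvdM // => /orP[//|pe].
  have : 0 < logn p e by rewrite logn_gt0 mem_primes pp e0.
  by rewrite loge Em.
by move: (Hlp isT) (Htp isT); rewrite -/t; lia.
Qed.

(** * Density of the exceptional integers *)

Lemma dfun_neq_ffunP (m : nat) : 0 < m -> dfun m != ffun m ->
  exists p, [/\ prime p, p ^ 2 %| m &
    all (fun q => ~~ (p ^ (2 * logn p m).-1 %| q.-1)) (primes m)].
Proof.
move=> m0 neq; apply: contrapT => H; move/eqP: neq; apply.
apply: dfun_eq_ffun => // p pp pm; apply: contrapT => Hq; apply: H.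
exists p; split=> //; apply/allP => q qm; apply/negP => pq.
by apply: Hq; exists q.
Qed.

(** The exceptional [m] lie in three sets, each of size at most [N / (4K)]: those divisible by [p^2]
    for a [p > z], those divisible by [p^A] for a small [p], and those with no prime factor [q = 1]
    modulo [p^(2A)] for a small [p]. *)
Lemma density0_dfun_neq_ffun : density0 (fun m => dfun m != ffun m).
Proof.
move=> [|k]; first by exists 0.
(* [z] serves the first set. For the second, [z] conditions hold for at most [N / 2^A] integers
   each, and [A <= 2^A]. *)
set K := k.+1; pose z := 4 * K; pose A := 4 * K * z.
(* The shift by 2 keeps every base at least 2; the factor [z] shares the third bound among [z]
   sets. *)
have [p _|N0 HN0] := @density0_finite_family
  (fun p m => all (fun q => ~~ (p.+2 ^ (2 * A) %| q.-1)) (primes m)) z (4 * K * z).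
  by apply: density0_no_prime_1mod; rewrite expn_gt0.
exists N0 => N NN.
pose c1 := \sum_(z.+1 <= p < N.+1) N %/ p ^ 2.
pose c2 := \sum_(p <- iota 0 z) N %/ p.+2 ^ A.
pose c3 := \sum_(p <- iota 0 z)
   count (fun m => all (fun q => ~~ (p.+2 ^ (2 * A) %| q.-1)) (primes m)) (iota 1 N).
have Hc : count (fun m => dfun m != ffun m) (iota 1 N) <= c1 + c2 + c3.
  apply: leq_trans (_ : count (fun m =>
      has (fun p => p ^ 2 %| m) (index_iota z.+1 N.+1) ||
      has (fun p => p.+2 ^ A %| m) (iota 0 z) ||
      has (fun p => all (fun q => ~~ (p.+2 ^ (2 * A) %| q.-1)) (primes m)) (iota 0 z))
      (iota 1 N) <= _).
    rewrite !count_iota_sum big_nat [X in _ <= X]big_nat; apply: leq_sum => m.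
    rewrite add1n ltnS => /andP[m0 mN].
    case: (boolP (dfun m != ffun m)) => // /(dfun_neq_ffunP m0)[p [pp pm Hall]].
    set b := (_ || _ || _); suff -> : b = true by [].
    have [zp|pz] := ltnP z p.
      apply/orP; left; apply/orP; left; apply/hasP; exists p => //.
      rewrite mem_index_iota zp ltnS (leq_trans _ mN) // dvdn_leq //.
      by apply: dvdn_trans pm; rewrite dvdn_exp.
    have p2 : p.-2.+2 = p by have := prime_gt1 pp; lia.
    have pz2 : p.-2 \in iota 0 z by rewrite mem_iota; have := prime_gt1 pp; lia.
    have [Aa|aA] := leqP A (logn p m).
      apply/orP; left; apply/orP; right; apply/hasP; exists p.-2 => //.
      by rewrite p2 pfactor_dvdn.
    (* Here the exponent [a] of [p] is below [A], so [p^(2a-1)] divides [p^(2A)], whose exponent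
       does not depend on [m]. *)
    apply/orP; right; apply/hasP; exists p.-2 => //; rewrite p2.
    apply/allP => q qm; apply: contra (allP Hall q qm); apply: dvdn_trans.
    by apply: dvdn_exp2l; lia.
  have cU (P Q : pred nat) s : count (fun m => P m || Q m) s <= count P s + count Q s.
    by rewrite -count_predUI leq_addr.
  apply: leq_trans (cU _ _ _) _; apply: leq_add.
    apply: leq_trans (cU _ _ _) _; apply: leq_add.
      rewrite /c1; under eq_bigr do rewrite -count_dvdn_iota.
      by apply: count_union_le => m _ /hasP.
    rewrite /c2; under eq_bigr do rewrite -count_dvdn_iota.
    by apply: count_union_le => m _ /hasP.
  by apply: count_union_le => m _ /hasP.
have H1 : z * c1 <= N by apply: sum_div_sqr_le.
have H2 : 4 * K * c2 <= N.
  apply: (@leq_trans (4 * K * (z * (N %/ 2 ^ A)))).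
    rewrite leq_mul2l /= /c2; apply: (@leq_trans (\sum_(p <- iota 0 z) N %/ 2 ^ A)).
      by apply: leq_sum => p _; rewrite leq_div2l ?expn_gt0 // leq_exp2r.
    by rewrite big_const_seq count_predT size_iota iter_addn_0 mulnC.
  rewrite mulnA -/A; apply: leq_trans (leq_trunc_div N (2 ^ A)).
  by rewrite mulnC leq_mul2l (ltnW (ltn_expl _ _)) ?orbT.
have H3 : z * (4 * K * c3) <= z * N.
  rewrite mulnA [z * _]mulnC /c3 big_distrr.
  apply: (@leq_trans (\sum_(p <- iota 0 z) N)).
    rewrite big_seq [X in _ <= X]big_seq; apply: leq_sum => p.
    by rewrite mem_iota add0n => /andP[_ /ltnW pz]; apply: HN0.
  by rewrite big_const_seq count_predT size_iota iter_addn_0 mulnC.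
move: H3; rewrite leq_mul2l /= => H3.
have H4 : K * count (fun m => dfun m != ffun m) (iota 1 N) <= K * (c1 + c2 + c3).
  by rewrite leq_mul2l Hc orbT.
rewrite /z in H1 H3; lia.
Qed.

Local Open Scope classical_set_scope.
Local Open Scope ring_scope.

Theorem theorem1p2 (R : realType) :
  (fun N : nat => (count_df N)%:R / N%:R : R) @ \oo --> (1 : R).
Proof.
apply/cvgrPdist_le => e e0.
pose k := (Num.bound e^-1).+1.
have ke : k%:R^-1 <= e.
  rewrite -[X in _ <= X]invrK lef_pV2 ?posrE ?invr_gt0 // ltW //.
  by apply: lt_trans (archi_boundP _) _; rewrite ?invr_ge0 ?(ltW e0) // ltr_nat.
have [N0 HN0] := density0_dfun_neq_ffun k.
exists (maxn N0 1) => // N /=; rewrite geq_max => /andP[NN0 N1].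
have cE : (count_df N + count (fun m => dfun m != ffun m) (iota 1 N))%N = N.
  by rewrite /count_df -[RHS](size_iota 1 N) -(count_predC (fun m => dfun m == ffun m)).
have Np : 0 < N%:R :> R by rewrite ltr0n.
have -> : 1 - (count_df N)%:R / N%:R =
    (count (fun m => dfun m != ffun m) (iota 1 N))%:R / N%:R :> R.
  by rewrite -[X in X - _](divff (lt0r_neq0 Np)) -mulrBl -{1}cE natrD addrAC subrr add0r.
rewrite ger0_norm ?divr_ge0 //; apply: le_trans ke.
rewrite ler_pdivrMr // ler_pdivlMl ?ltr0n // -natrM ler_nat.
exact: HN0.
Qed.
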